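(* Let $\mathcal{H}=\mathcal{H}(\Omega)$ be a functional (reproducing kernel) Hilbert space on a nonempty set $\Omega$, let $t\in[0,1]$ and let $A,B\in\mathcal{B}(\mathcal{H})$. Then, for the following operators on $\mathcal{H}\oplus\mathcal{H}$: (1) $\left\|\begin{pmatrix} A & 0 \\ 0 & B \end{pmatrix}\right\|_{t-ber}\le\max\{\|A\|_{t-ber},\|B\|_{t-ber}\}$. (2) $\left\|\begin{pmatrix} 0 & A \\ B & 0 \end{pmatrix}\right\|_{t-ber}=\left\|\begin{pmatrix} 0 & B \\ A & 0 \end{pmatrix}\right\|_{t-ber}$. (3) $\left\|\begin{pmatrix} 0 & A \\ 0 & 0 \end{pmatrix}\right\|_{t-ber}\le\max\{t,1-t\}\,\|A\|_{ber}$.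
   Context: A functional (reproducing kernel) Hilbert space $\mathcal{H}=\mathcal{H}(\Omega)$ is a Hilbert space of complex-valued functions on a nonempty set $\Omega$ such that for every $\lambda\in\Omega$ the evaluation $f\mapsto f(\lambda)$ is a continuous linear functional; $k_\lambda\in\mathcal{H}$ is the unique element with $f(\lambda)=\langle f,k_\lambda\rangle$ for all $f\in\mathcal{H}$. It is assumed that $k_\lambda\neq0$ for all $\lambda\in\Omega$, and $\hat{k}_\lambda=k_\lambda/\|k_\lambda\|$ is the normalized reproducing kernel. $\mathcal{B}(\mathcal{H})$ is the algebra of bounded linear operators on $\mathcal{H}$. For $A\in\mathcal{B}(\mathcal{H})$ and $t\in[0,1]$, $$\|A\|_{t-ber}=\sup_{\lambda,\mu\in\Omega}\left\{t|\langle A\hat{k}_\lambda,\hat{k}_\mu\rangle|+(1-t)|\langle A^*\hat{k}_\lambda,\hat{k}_\mu\rangle|\right\},\qquad \|A\|_{ber}=\sup_{\lambda,\mu\in\Omega}|\langle A\hat{k}_\lambda,\hat{k}_\mu\rangle|.$$ For operators on $\mathcal{H}\oplus\mathcal{H}$ the index set is $\Omega\times\Omega$, the kernel at $(\lambda_1,\lambda_2)$ is the vector $(k_{\lambda_1},k_{\lambda_2})\in\mathcal{H}\oplus\mathcal{H}$, and its normalization is $\hat{k}_{(\lambda_1,\lambda_2)}=(k_{\lambda_1},k_{\lambda_2})/\sqrt{\|k_{\lambda_1}\|^2+\|k_{\lambda_2}\|^2}$; thus for $T\in\mathcal{B}(\mathcal{H}\oplus\mathcal{H})$, $$\|T\|_{t-ber}=\sup\left\{t|\langle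 T\hat{k}_{(\lambda_1,\lambda_2)},\hat{k}_{(\mu_1,\mu_2)}\rangle|+(1-t)|\langle T^*\hat{k}_{(\lambda_1,\lambda_2)},\hat{k}_{(\mu_1,\mu_2)}\rangle|:(\lambda_1,\lambda_2),(\mu_1,\mu_2)\in\Omega\times\Omega\right\}.$$ *)

(* Defs.v *)
From Stdlib Require Export Reals.
From Stdlib Require Import ClassicalEpsilon Lra.
From Coquelicot Require Export Coquelicot.

Set Implicit Arguments.
Unset Strict Implicit.
Unset Printing Implicit Defensive.

Local Open Scope R_scope.

(* A complex Hilbert space: a Banach space over C whose norm comes from an
   inner product, linear in the first argument. *)
Record Hilbert : Type := {
  hilbert_space :> CompleteNormedModule C_AbsRing;
  inner : hilbert_space -> hilbert_space -> C;
  inner_plus_l : forall x y z : hilbert_space,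
    inner (plus x y) z = Cplus (inner x z) (inner y z);
  inner_scal_l : forall (a : C) (x y : hilbert_space),
    inner (scal a x) y = Cmult a (inner x y);
  inner_conj : forall x y : hilbert_space, inner y x = Cconj (inner x y);
  inner_norm : forall x : hilbert_space, inner x x = RtoC (norm x ^ 2)
}.

Arguments inner {h} _ _.

Section DirectSum.

Variables H K : Hilbert.

Let lim_prod (F : (H * K -> Prop) -> Prop) : H * K :=
  (lim (filtermap fst F), lim (filtermap snd F)).

Lemma dsum_lim_cauchy (F : (H * K -> Prop) -> Prop) :
  ProperFilter F ->
  @cauchy (prod_UniformSpace H K) F ->
  forall eps : posreal, F (@ball (prod_UniformSpace H K) (lim_prod F) eps).
Proof.
intros HF Hc eps.
assert (H1 : filtermap fst F (ball (lim (filtermap fst F)) eps)).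
{ apply complete_cauchy.
  - now apply filtermap_proper_filter.
  - intros e; destruct (Hc e) as [x Hx]; exists (fst x).
    unfold filtermap; apply (filter_imp (F := F)) with (2 := Hx).
    now intros y Hy; apply Hy. }
assert (H2 : filtermap snd F (ball (lim (filtermap snd F)) eps)).
{ apply complete_cauchy.
  - now apply filtermap_proper_filter.
  - intros e; destruct (Hc e) as [x Hx]; exists (snd x).
    unfold filtermap; apply (filter_imp (F := F)) with (2 := Hx).
    now intros y Hy; apply Hy. }
unfold filtermap in H1, H2.
apply (filter_imp (F := F)) with (2 := filter_and _ _ H1 H2).
intros x [Hx1 Hx2]; exact (conj Hx1 Hx2).
Qed.

Lemma dsum_lim_close (F1 F2 : (H * K -> Prop) -> Prop) :
  filter_le F1 F2 -> filter_le F2 F1 ->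
  @close (prod_UniformSpace H K) (lim_prod F1) (lim_prod F2).
Proof.
intros H12 H21 eps; split.
- refine (close_lim (filtermap fst F1) (filtermap fst F2) _ _ eps);
    intros P; [apply H12 | apply H21].
- refine (close_lim (filtermap snd F1) (filtermap snd F2) _ _ eps);
    intros P; [apply H12 | apply H21].
Qed.

(* The underlying normed module is Coquelicot's product, whose norm is
   sqrt (norm x ^ 2 + norm y ^ 2). *)
Definition dsum_space : CompleteNormedModule C_AbsRing :=
  CompleteNormedModule.Pack C_AbsRing (H * K)%type
    (CompleteNormedModule.Class C_AbsRing (H * K)%type
       (NormedModule.class C_AbsRing (prod_NormedModule C_AbsRing H K))
       (CompleteSpace.Mixin (prod_UniformSpace H K) lim_prod
          dsum_lim_cauchy dsum_lim_close))
    (H * K)%type.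

Definition dsum_inner (x y : dsum_space) : C :=
  Cplus (inner (fst x) (fst y)) (inner (snd x) (snd y)).

Lemma dsum_inner_plus_l (x y z : dsum_space) :
  dsum_inner (plus x y) z = Cplus (dsum_inner x z) (dsum_inner y z).
Proof.
destruct x as [x1 x2], y as [y1 y2], z as [z1 z2].
change (Cplus (inner (plus x1 y1) z1) (inner (plus x2 y2) z2) =
  Cplus (Cplus (inner x1 z1) (inner x2 z2))
        (Cplus (inner y1 z1) (inner y2 z2))).
rewrite !inner_plus_l; ring.
Qed.

Lemma dsum_inner_scal_l (a : C) (x y : dsum_space) :
  dsum_inner (scal a x) y = Cmult a (dsum_inner x y).
Proof.
destruct x as [x1 x2], y as [y1 y2].
change (Cplus (inner (scal a x1) y1) (inner (scal a x2) y2) =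
  Cmult a (Cplus (inner x1 y1) (inner x2 y2))).
rewrite !inner_scal_l; ring.
Qed.

Lemma dsum_inner_conj (x y : dsum_space) :
  dsum_inner y x = Cconj (dsum_inner x y).
Proof.
unfold dsum_inner.
now rewrite (inner_conj (fst x)), (inner_conj (snd x)), Cplus_conj.
Qed.

Lemma dsum_inner_norm (x : dsum_space) :
  dsum_inner x x = RtoC (norm x ^ 2).
Proof.
destruct x as [x1 x2].
change (Cplus (inner x1 x1) (inner x2 x2) =
  RtoC (sqrt (norm x1 ^ 2 + norm x2 ^ 2) ^ 2)).
rewrite pow2_sqrt, !inner_norm, RtoC_plus; [reflexivity|].
generalize (pow2_ge_0 (norm x1)) (pow2_ge_0 (norm x2)); lra.
Qed.

Definition dsum : Hilbert := {|
  hilbert_space := dsum_space;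
  inner := dsum_inner;
  inner_plus_l := dsum_inner_plus_l;
  inner_scal_l := dsum_inner_scal_l;
  inner_conj := dsum_inner_conj;
  inner_norm := dsum_inner_norm
|}.

End DirectSum.

(* Coquelicot's is_linear includes boundedness. *)
Record BOp (H K : Hilbert) : Type := {
  op :> H -> K;
  op_linear : is_linear op
}.

Definition zero_op (H K : Hilbert) : BOp H K :=
  {| op := fun _ => zero; op_linear := is_linear_zero |}.

(* Existence of the adjoint, and of the reproducing kernel below, is the Riesz
   representation theorem, and uniqueness follows from definiteness of the inner
   product; hence the choice made by epsilon is immaterial. *)
Definition adjoint (H K : Hilbert) (T : BOp H K) : BOp K H :=
  epsilon (inhabits (zero_op K H))
    (fun S => forall (x : H) (y : K), inner (T x) y = inner x (S y)).

Section Block.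

Variables (H1 H2 K1 K2 : Hilbert).
Variables (A : BOp H1 K1) (B : BOp H2 K1) (C : BOp H1 K2) (D : BOp H2 K2).

Definition block_fun (x : dsum H1 H2) : dsum K1 K2 :=
  (plus (A (fst x)) (B (snd x)), plus (C (fst x)) (D (snd x))).

Lemma block_linear : is_linear block_fun.
Proof.
apply (@is_linear_prod _ (prod_NormedModule _ H1 H2) K1 K2
  (fun x : H1 * H2 => plus (A (fst x)) (B (snd x)))
  (fun x : H1 * H2 => plus (C (fst x)) (D (snd x)))).
- apply (is_linear_comp (fun x : H1 * H2 => (A (fst x), B (snd x)))
    (fun y : K1 * K1 => plus (fst y) (snd y))).
  + apply is_linear_prod.
    * exact (is_linear_comp _ _ is_linear_fst (op_linear A)).
    * exact (is_linear_comp _ _ is_linear_snd (op_linear B)).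
  + exact is_linear_plus.
- apply (is_linear_comp (fun x : H1 * H2 => (C (fst x), D (snd x)))
    (fun y : K2 * K2 => plus (fst y) (snd y))).
  + apply is_linear_prod.
    * exact (is_linear_comp _ _ is_linear_fst (op_linear C)).
    * exact (is_linear_comp _ _ is_linear_snd (op_linear D)).
  + exact is_linear_plus.
Qed.

(* The operator matrix with rows (A, B) and (C, D). *)
Definition block : BOp (dsum H1 H2) (dsum K1 K2) :=
  {| op := block_fun; op_linear := block_linear |}.

End Block.

(* A Hilbert space of complex-valued functions on Omega: eval identifies its
   elements with functions, and the vector space operations are pointwise. *)
Record RKHS (Omega : Type) : Type := {
  rkhs_hilbert :> Hilbert;
  eval : rkhs_hilbert -> Omega -> C;
  eval_inj : forall f g : rkhs_hilbert,
    (forall l : Omega, eval f l = eval g l) -> f = g;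
  eval_plus : forall (f g : rkhs_hilbert) (l : Omega),
    eval (plus f g) l = Cplus (eval f l) (eval g l);
  eval_scal : forall (a : C) (f : rkhs_hilbert) (l : Omega),
    eval (scal a f) l = Cmult a (eval f l);
  eval_continuous : forall (l : Omega) (f : rkhs_hilbert),
    continuous (fun g : rkhs_hilbert => eval g l) f
}.

Definition kernel (Omega : Type) (H : RKHS Omega) (l : Omega) : H :=
  epsilon (inhabits zero)
    (fun k : H => forall f : H, eval f l = inner f k).

Definition normalize (H : Hilbert) (x : H) : H := scal (RtoC (/ norm x)) x.

Definition nkernel (Omega : Type) (H : RKHS Omega) (l : Omega) : H :=
  normalize (kernel H l).

Definition nkernel2 (Omega : Type) (H : RKHS Omega) (l : Omega * Omega) :
    dsum H H :=
  normalize ((kernel H (fst l), kernel H (snd l)) : dsum H H).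

(* For a nonempty family e of unit vectors and a bounded operator T the suprema
   below are over nonempty bounded sets of reals, so that the projection real
   loses nothing. *)
Definition tber_of (I : Type) (H : Hilbert) (e : I -> H) (t : R)
    (T : BOp H H) : R :=
  real (Lub_Rbar (fun r : R => exists l m : I,
    r = t * Cmod (inner (T (e l)) (e m))
        + (1 - t) * Cmod (inner (adjoint T (e l)) (e m)))).

Definition tber (Omega : Type) (H : RKHS Omega) (t : R) (A : BOp H H) : R :=
  tber_of (nkernel H) t A.

Definition tber2 (Omega : Type) (H : RKHS Omega) (t : R)
    (T : BOp (dsum H H) (dsum H H)) : R :=
  tber_of (nkernel2 H) t T.

Definition ber (Omega : Type) (H : RKHS Omega) (A : BOp H H) : R :=
  real (Lub_Rbar (fun r : R => exists l m : Omega,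
    r = Cmod (inner (A (nkernel H l)) (nkernel H m)))).

(* Main.v *)
Require Import Defs.
From Stdlib Require Import ssreflect ClassicalEpsilon Lra.
Local Open Scope R_scope.

(** The reproducing property plays no role: only that every kernel vector
    [k] is nonzero matters.  By sesquilinearity, the supremum defining the
    t-Berezin norm of [T] is the least constant [N] such that
    [t |<T k_l, k_m>| + (1 - t) |<T k_m, k_l>| <= N |k_l| |k_m|]
    for all indices [l], [m] ([tber_of_upper] and [tber_of_lub]); here
    [|<T^* x, y>| = |<T y, x>|] ([Cmod_inner_adjoint]), so adjoints of block
    operators never have to be computed.  Each claim becomes an inequality
    between unnormalized vectors of [H + H]:

    - for [diag (A, B)] the form splits over the two summands, is bounded by
      [N (|x1| |y1| + |x2| |y2|)] with [N] the larger of the two norms, and the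
      Cauchy-Schwarz inequality in the plane gives [N |x| |y|];
    - exchanging both coordinates of both indices carries the form of the
      off-diagonal operator of [A], [B] to that of [B], [A];
    - with [A] as the only nonzero entry, the two terms are at most
      [t N |x2| |y1|] and [(1 - t) N |y2| |x1|], where [N] is now
      the Berezin norm of [A], and the planar Cauchy-Schwarz
      inequality applies again.

    The identity for [T^*] needs the adjoint to exist, that is, the Riesz
    representation theorem ([riesz]).  The vector representing a bounded
    functional [phi] is the maximizer of [2 Re (phi x) - |x|^2], obtained from
    the parallelogram identity and completeness. *)

(** * Inner products *)

Section InnerProduct.

Context {H : Hilbert}.
Implicit Types x y z : H.

(** These two restate general facts so that their types mention the same
    structure instances as the statements about [H]. *)
Lemma hnorm_ge_0 x : 0 <= norm x.
Proof. exact (@norm_ge_0 C_AbsRing H x). Qed.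

Lemma hnorm_triangle x y : norm (plus x y) <= norm x + norm y.
Proof. exact (@norm_triangle C_AbsRing H x y). Qed.

Lemma inner_plus_r x y z : inner x (plus y z) = Cplus (inner x y) (inner x z).
Proof.
  rewrite inner_conj inner_plus_l Cplus_conj -!inner_conj; reflexivity.
Qed.

Lemma inner_scal_r (a : C) x y :
  inner x (scal a y) = Cmult (Cconj a) (inner x y).
Proof.
  rewrite inner_conj inner_scal_l Cmult_conj -!inner_conj; reflexivity.
Qed.

Lemma inner_opp_l x y : inner (opp x) y = Copp (inner x y).
Proof.
  replace (opp x) with (scal (opp (one : C_AbsRing)) x)
    by exact (@scal_opp_one C_AbsRing H x).
  rewrite inner_scal_l.
  change (@opp C_AbsRing one) with (Copp (RtoC 1)); ring.
Qed.

Lemma inner_opp_r x y : inner x (opp y) = Copp (inner x y).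
Proof.
  rewrite inner_conj inner_opp_l inner_conj.
  destruct (inner x y) as [u v]; unfold Cconj, Copp; simpl; f_equal; ring.
Qed.

Lemma inner_zero_l x : inner (zero : H) x = RtoC 0.
Proof.
  replace (zero : H) with (scal (zero : C_AbsRing) x)
    by exact (@scal_zero_l C_AbsRing H x).
  rewrite inner_scal_l.
  change (@zero C_AbsRing) with (RtoC 0); ring.
Qed.

Lemma Cmod_inner_sym x y : Cmod (inner x y) = Cmod (inner y x).
Proof. rewrite inner_conj; apply Cmod_conj. Qed.

Lemma Re_inner_sym x y : Re (inner x y) = Re (inner y x).
Proof. rewrite inner_conj; reflexivity. Qed.

Lemma norm_sqr x : norm x ^ 2 = Re (inner x x).
Proof. rewrite inner_norm; reflexivity. Qed.

Lemma norm_plus_sqr x y :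
  norm (plus x y) ^ 2 = norm x ^ 2 + 2 * Re (inner x y) + norm y ^ 2.
Proof.
  rewrite !norm_sqr inner_plus_l !inner_plus_r.
  generalize (Re_inner_sym x y).
  destruct (inner x x), (inner x y), (inner y x), (inner y y); simpl; lra.
Qed.

Lemma norm_minus_sqr x y :
  norm (minus x y) ^ 2 = norm x ^ 2 - 2 * Re (inner x y) + norm y ^ 2.
Proof.
  unfold minus; rewrite norm_plus_sqr inner_opp_r.
  replace (norm (opp y)) with (norm y)
    by (symmetry; exact (@norm_opp C_AbsRing H y)).
  destruct (inner x y); simpl; ring.
Qed.

Lemma norm_scal_C (a : C) x : norm (scal a x) = Cmod a * norm x.
Proof.
  apply Rsqr_inj.
  - apply hnorm_ge_0.
  - apply Rmult_le_pos; [apply Cmod_ge_0 | apply hnorm_ge_0].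
  - rewrite !Rsqr_pow2 Rpow_mult_distr !norm_sqr inner_scal_l inner_scal_r.
    rewrite Cmult_assoc -Cmod2_conj inner_norm -RtoC_mult; reflexivity.
Qed.

Lemma norm_pos x : x <> zero -> 0 < norm x.
Proof.
  intros Hx; destruct (hnorm_ge_0 x) as [|E]; [assumption|].
  elim Hx; exact (@norm_eq_zero C_AbsRing H x (eq_sym E)).
Qed.

(** For the real part, Cauchy-Schwarz is the squared triangle inequality. *)
Lemma Re_inner_le x y : Re (inner x y) <= norm x * norm y.
Proof.
  generalize (hnorm_triangle x y) (norm_plus_sqr x y) (hnorm_ge_0 (plus x y))
    (hnorm_ge_0 x) (hnorm_ge_0 y); intros; nra.
Qed.

Lemma cauchy_schwarz x y : Cmod (inner x y) <= norm x * norm y.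
Proof.
  set (c := inner x y).
  destruct (Cmod_ge_0 c) as [Hc|Hc].
  2:{ rewrite -Hc; apply Rmult_le_pos; apply hnorm_ge_0. }
  (* Rotating and scaling [x] by [Cconj c] makes the inner product real. *)
  generalize (Re_inner_le (scal (Cconj c) x) y).
  rewrite inner_scal_l norm_scal_C Cmod_conj.
  fold c; rewrite Cmult_comm -Cmod2_conj; simpl Re; intros; nra.
Qed.

Lemma inner_ext_r x y : (forall z, inner z x = inner z y) -> x = y.
Proof.
  intros E.
  assert (N : norm (minus x y) ^ 2 = 0).
  { rewrite norm_sqr; unfold minus at 2.
    rewrite inner_plus_r inner_opp_r E.
    destruct (inner (minus x y) y); simpl; ring. }
  assert (N' : minus x y = zero).
  { apply (@norm_eq_zero C_AbsRing H).
    generalize (hnorm_ge_0 (minus x y)); intros; nra. }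
  exact (@plus_reg_r H (opp y) x y (eq_trans N' (eq_sym (@plus_opp_r H y)))).
Qed.

End InnerProduct.

(** * The Riesz representation theorem and adjoints *)

Lemma nonpos_of_le_eps (u K : R) :
  0 <= K -> (forall eps, 0 < eps -> u <= eps * K) -> u <= 0.
Proof.
  intros HK Hu; apply Rnot_lt_le; intros Hpos.
  assert (E : u / (2 * (K + 1)) * K <= u / 2).
  { apply (Rmult_le_reg_r (2 * (K + 1))); [lra|].
    replace (u / (2 * (K + 1)) * K * (2 * (K + 1))) with (u * K) by (field; lra).
    nra. }
  assert (P : 0 < u / (2 * (K + 1))) by (apply Rdiv_lt_0_compat; lra).
  specialize (Hu _ P); lra.
Qed.

Section Riesz.

Variables (H : Hilbert) (phi : H -> C) (M : R).
Hypothesis phi_plus : forall x y, phi (plus x y) = Cplus (phi x) (phi y).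
Hypothesis phi_scal : forall a x, phi (scal a x) = Cmult a (phi x).
Hypothesis phi_bounded : forall x, Cmod (phi x) <= M * norm x.

(** Since [G x = |w|^2 - |x - w|^2] when [w] represents [phi], the vector
    sought is the maximizer of [G]. *)
Let G (x : H) : R := 2 * Re (phi x) - norm x ^ 2.

Lemma riesz_G_bounded x : G x <= M ^ 2.
Proof.
  unfold G; generalize (re_le_Cmod (phi x)) (phi_bounded x) (Rle_abs (Re (phi x))).
  generalize (pow2_ge_0 (M - norm x)); intros; nra.
Qed.

Lemma riesz_G_parallelogram x y :
  exists p, norm (minus y x) ^ 2 = 4 * G p - 2 * G x - 2 * G y.
Proof.
  exists (scal (RtoC (/ 2)) (plus x y)); unfold G.
  rewrite norm_scal_C Rpow_mult_distr norm_minus_sqr norm_plus_sqr.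
  rewrite (Re_inner_sym y x) phi_scal phi_plus.
  rewrite Cmod_R pow2_abs.
  destruct (phi x), (phi y); simpl; field.
Qed.

Lemma riesz_G_variation x h s :
  G (plus x (scal (RtoC s) h))
  = G x + 2 * s * (Re (phi h) - Re (inner x h)) - s ^ 2 * norm h ^ 2.
Proof.
  unfold G.
  rewrite norm_plus_sqr norm_scal_C Rpow_mult_distr Cmod_R pow2_abs.
  rewrite inner_scal_r phi_plus phi_scal.
  destruct (phi x), (phi h), (inner x h); simpl; ring.
Qed.

Lemma riesz_Re : exists z : H, forall h, Re (inner z h) = Re (phi h).
Proof.
  destruct (completeness (fun r => exists x, r = G x)) as [m [mub mlub]].
  { exists (M ^ 2); intros r [x ->]; apply riesz_G_bounded. }
  { now exists (G zero), zero. }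
  assert (Gm : forall x, G x <= m) by (intros x; apply mub; now exists x).
  assert (near : forall d, 0 < d -> exists x, m - d < G x).
  { intros d Hd; apply NNPP; intros N.
    assert (m <= m - d); [|lra].
    apply mlub; intros r [x ->]; apply Rnot_lt_le; intros Hx.
    apply N; now exists x. }
  (* The filter of near-maximizers; it is Cauchy by the parallelogram identity. *)
  set (F := fun P : H -> Prop => exists d, 0 < d /\ forall x, m - d < G x -> P x).
  assert (PF : ProperFilter F).
  { split; [|split].
    - intros P [d [Hd HP]]; destruct (near d Hd) as [x Hx]; now exists x; apply HP.
    - exists 1; split; [lra|trivial].
    - intros P Q [d [Hd HP]] [e [He HQ]]; exists (Rmin d e); split.
      + now apply Rmin_pos.
      + intros x Hx; generalize (Rmin_l d e) (Rmin_r d e); intros; split;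
          [apply HP | apply HQ]; lra.
    - intros P Q PQ [d [Hd HP]]; exists d; split; [assumption|].
      intros x Hx; now apply PQ, HP. }
  assert (CF : cauchy F).
  { intros eps.
    assert (He := cond_pos eps).
    assert (Hd : 0 < eps ^ 2 / 4) by nra.
    destruct (near _ Hd) as [x Hx]; exists x.
    exists (eps ^ 2 / 4); split; [assumption|]; intros y Hy.
    apply (norm_compat1 (V := H)).
    destruct (riesz_G_parallelogram x y) as [p E].
    assert (E' := Gm p).
    assert (E0 := hnorm_ge_0 (minus y x)).
    change (norm (minus y x : H) < eps).
    set (n := norm (minus y x : H)) in *.
    change (n ^ 2 = 4 * G p - 2 * G x - 2 * G y) in E.
    assert (n ^ 2 < eps ^ 2) by lra.
    nra. }
  exists (lim F); intros h.
  set (z := lim F).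
  set (nf := @norm_factor C_AbsRing H).
  assert (Hnf : 0 < nf) by apply norm_factor_gt_0.
  assert (Hh := hnorm_ge_0 h).
  set (a := Re (phi h) - Re (inner z h)).
  assert (key : forall s, 2 * s * a - s ^ 2 * norm h ^ 2 <= 0).
  { intros s.
    assert (Hs := Rabs_pos s).
    apply nonpos_of_le_eps with (K := 1 + 2 * Rabs s * (nf * norm h)).
    - assert (0 <= nf * norm h) by nra; nra.
    - intros eps Heps.
      (* A near-maximizer close to [z], moved by [s h], cannot exceed [m]. *)
      assert (B := complete_cauchy F PF CF (mkposreal eps Heps)).
      assert (N : F (fun x => m - eps < G x)) by (now exists eps; split).
      destruct (filter_ex _ (filter_and _ _ B N)) as [x [Bx Nx]].
      apply (norm_compat2 (V := H)) in Bx; fold z nf in Bx; simpl in Bx.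
      assert (V := Gm (plus x (scal (RtoC s) h))).
      rewrite riesz_G_variation in V.
      assert (D : Rabs (Re (inner x h) - Re (inner z h)) <= nf * eps * norm h).
      { replace (Re (inner x h) - Re (inner z h)) with (Re (inner (minus x z) h)).
        - eapply Rle_trans; [apply re_le_Cmod|].
          eapply Rle_trans; [apply cauchy_schwarz|].
          apply Rmult_le_compat_r; [apply Hh|].
          apply Rlt_le, Bx.
        - unfold minus; rewrite inner_plus_l inner_opp_l.
          destruct (inner x h), (inner z h); simpl; ring. }
      assert (E : s * (Re (inner x h) - Re (inner z h))
                  <= Rabs s * (nf * eps * norm h)).
      { eapply Rle_trans; [apply Rle_abs|]; rewrite Rabs_mult.
        now apply Rmult_le_compat_l. }
      unfold a; nra. }
  (* The derivative [2 a] at [0] of a quadratic maximal at [0] vanishes; the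
     value [a / (norm h ^ 2 + 1)] also covers [h = zero]. *)
  assert (K := key (a / (norm h ^ 2 + 1))).
  set (n := norm h ^ 2) in *.
  assert (Hn : 0 <= n) by apply pow2_ge_0.
  replace (2 * (a / (n + 1)) * a - (a / (n + 1)) ^ 2 * n)
    with ((a / (n + 1)) ^ 2 * (n + 2)) in K by (field; lra).
  assert (Z : a / (n + 1) = 0) by (generalize (pow2_ge_0 (a / (n + 1))); nra).
  assert (a = 0).
  { replace a with (a / (n + 1) * (n + 1)) by (field; lra); rewrite Z; ring. }
  unfold a in *; lra.
Qed.

Lemma riesz : exists z : H, forall x, phi x = inner x z.
Proof.
  destruct riesz_Re as [z Hz]; exists z; intros x.
  assert (E1 := Hz x).
  (* The imaginary parts agree by applying the real case to [i x]. *)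
  assert (E2 := Hz (scal Ci x)).
  rewrite phi_scal inner_scal_r in E2.
  rewrite (inner_conj z x).
  destruct (phi x), (inner z x); unfold Cconj; simpl in *; f_equal; lra.
Qed.

End Riesz.

Lemma adjoint_exists (H K : Hilbert) (T : BOp H K) :
  exists S : BOp K H, forall x y, inner (T x) y = inner x (S y).
Proof.
  destruct (op_linear T) as [Tplus Tscal [M [HM Tbd]]].
  assert (R : forall y, exists w, forall x, inner (T x) y = inner x w).
  { intros y; apply (riesz H (fun x => inner (T x) y) (M * norm y)).
    - intros x1 x2; rewrite Tplus; apply inner_plus_l.
    - intros a x; rewrite Tscal; apply inner_scal_l.
    - intros x; eapply Rle_trans; [apply cauchy_schwarz|].
      generalize (Rmult_le_compat_r _ _ _ (hnorm_ge_0 y) (Tbd x)); lra. }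
  set (S := fun y => epsilon (inhabits zero)
    (fun w : H => forall x, inner (T x) y = inner x w)).
  assert (HS : forall x y, inner (T x) y = inner x (S y)).
  { intros x y; revert x; exact (epsilon_spec _ _ (R y)). }
  assert (LS : is_linear S).
  { split.
    - intros y1 y2; apply inner_ext_r; intros x.
      rewrite inner_plus_r -!HS; apply inner_plus_r.
    - intros a y; apply inner_ext_r; intros x.
      rewrite inner_scal_r -!HS; apply inner_scal_r.
    - exists M; split; [assumption|]; intros y.
      (* [|S y|^2 = Re <T (S y), y> <= M |S y| |y|] *)
      assert (E := Re_inner_le (T (S y)) y).
      rewrite HS -norm_sqr in E.
      generalize (Tbd (S y)) (hnorm_ge_0 (S y)) (hnorm_ge_0 y); intros.
      destruct (hnorm_ge_0 (S y)) as [P|P]; [|rewrite -P; nra].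
      apply (Rmult_le_reg_l (norm (S y))); [assumption|]; nra. }
  now exists {| op := S; op_linear := LS |}.
Qed.

Lemma inner_adjoint (H K : Hilbert) (T : BOp H K) x y :
  inner (T x) y = inner x (adjoint T y).
Proof.
  revert x y.
  exact (epsilon_spec (inhabits (zero_op K H))
    (fun S : BOp K H => forall x y, inner (T x) y = inner x (S y))
    (adjoint_exists H K T)).
Qed.

Lemma Cmod_inner_adjoint (H K : Hilbert) (T : BOp H K) x y :
  Cmod (inner (adjoint T x) y) = Cmod (inner (T y) x).
Proof. rewrite Cmod_inner_sym -inner_adjoint; reflexivity. Qed.

(** * Berezin-type suprema without normalization *)

Lemma real_Lub_upper (E : R -> Prop) (b r : R) :
  (forall x, E x -> x <= b) -> E r -> r <= real (Lub_Rbar E).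
Proof.
  intros Hb Hr; destruct (Lub_Rbar_correct E) as [U L].
  assert (U' := U r Hr).
  assert (L' := L b Hb).
  now destruct (Lub_Rbar E).
Qed.

Lemma real_Lub_least (E : R -> Prop) (b r : R) :
  E r -> (forall x, E x -> x <= b) -> real (Lub_Rbar E) <= b.
Proof.
  intros Hr Hb; destruct (Lub_Rbar_correct E) as [U L].
  assert (U' := U r Hr).
  assert (L' := L b Hb).
  now destruct (Lub_Rbar E).
Qed.

Lemma BOp_form_bounded (H : Hilbert) (T : BOp H H) :
  exists M, forall x y, Cmod (inner (T x) y) <= M * (norm x * norm y).
Proof.
  destruct (op_linear T) as [_ _ [M [HM Tbd]]]; exists M; intros x y.
  eapply Rle_trans; [apply cauchy_schwarz|].
  generalize (Rmult_le_compat_r _ _ _ (hnorm_ge_0 y) (Tbd x)); lra.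
Qed.

Lemma Cmod_inner_normalize (H : Hilbert) (T : BOp H H) (x y : H) :
  x <> zero -> y <> zero ->
  Cmod (inner (T (normalize x)) (normalize y))
  = Cmod (inner (T x) y) / (norm x * norm y).
Proof.
  intros Hx Hy; apply norm_pos in Hx; apply norm_pos in Hy.
  unfold normalize.
  rewrite (linear_scal _ (op_linear T)) inner_scal_l inner_scal_r.
  rewrite !Cmod_mult Cmod_conj !Cmod_R !Rabs_pos_eq;
    [field; lra| |]; apply Rlt_le, Rinv_0_lt_compat; assumption.
Qed.

(** The quantity [t |<T x, y>| + (1 - t) |<T^* x, y>|], written without the
    adjoint. *)
Definition tform (H : Hilbert) (t : R) (T : BOp H H) (x y : H) : R :=
  t * Cmod (inner (T x) y) + (1 - t) * Cmod (inner (T y) x).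

Section Berezin.

Variables (I : Type) (H : Hilbert) (k : I -> H) (T : BOp H H) (t : R).
Hypothesis k_neq0 : forall i, k i <> zero.
Hypothesis t01 : 0 <= t <= 1.

Lemma norm_mult_pos l m : 0 < norm (k l) * norm (k m).
Proof. apply Rmult_lt_0_compat; now apply norm_pos. Qed.

Lemma tform_normalize l m :
  t * Cmod (inner (T (normalize (k l))) (normalize (k m)))
    + (1 - t) * Cmod (inner (adjoint T (normalize (k l))) (normalize (k m)))
  = tform H t T (k l) (k m) / (norm (k l) * norm (k m)).
Proof.
  unfold tform; rewrite Cmod_inner_adjoint !Cmod_inner_normalize; trivial.
  generalize (norm_pos _ (k_neq0 l)) (norm_pos _ (k_neq0 m)); intros.
  field; lra.
Qed.

Lemma tber_of_upper l m :
  tform H t T (k l) (k m)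
  <= tber_of (fun i => normalize (k i)) t T * (norm (k l) * norm (k m)).
Proof.
  apply Rle_div_l; [apply norm_mult_pos|].
  destruct (BOp_form_bounded H T) as [M HM].
  apply real_Lub_upper with (b := M).
  - intros x [i [j ->]]; rewrite tform_normalize.
    apply Rle_div_l; [apply norm_mult_pos|]; unfold tform.
    generalize (HM (k i) (k j)) (HM (k j) (k i)); intros; nra.
  - exists l, m; now rewrite tform_normalize.
Qed.

Lemma tber_of_lub (N : R) :
  inhabited I ->
  (forall l m, tform H t T (k l) (k m) <= N * (norm (k l) * norm (k m))) ->
  tber_of (fun i => normalize (k i)) t T <= N.
Proof.
  intros [i] HN; eapply real_Lub_least.
  - now exists i, i.
  - intros x [l [m ->]]; rewrite tform_normalize.
    apply Rle_div_l; [apply norm_mult_pos | apply HN].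
Qed.

End Berezin.

Lemma ber_upper (Omega : Type) (H : RKHS Omega)
    (Hker : forall l, kernel H l <> zero) (A : BOp H H) l m :
  Cmod (inner (A (kernel H l)) (kernel H m))
  <= ber A * (norm (kernel H l) * norm (kernel H m)).
Proof.
  assert (P : forall i j, 0 < norm (kernel H i) * norm (kernel H j))
    by (intros i j; exact (norm_mult_pos _ _ _ Hker i j)).
  apply Rle_div_l; [apply P|].
  destruct (BOp_form_bounded H A) as [M HM].
  apply real_Lub_upper with (b := M).
  - intros x [i [j ->]]; unfold nkernel; rewrite Cmod_inner_normalize; trivial.
    apply Rle_div_l; [apply P | apply HM].
  - exists l, m; unfold nkernel; now rewrite Cmod_inner_normalize.
Qed.

(** * Block operators *)

Lemma norm_dsum (H K : Hilbert) (x1 : H) (x2 : K) :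
  norm ((x1, x2) : dsum H K) = sqrt (norm x1 ^ 2 + norm x2 ^ 2).
Proof. reflexivity. Qed.

(** The Cauchy-Schwarz inequality in the plane. *)
Lemma norm_dsum_mult_ge (H : Hilbert) (x1 x2 y1 y2 : H) :
  norm x1 * norm y1 + norm x2 * norm y2
  <= norm ((x1, x2) : dsum H H) * norm ((y1, y2) : dsum H H).
Proof.
  rewrite !norm_dsum -!Rsqr_pow2; apply sqrt_cauchy.
Qed.

Lemma inner_block (H : Hilbert) (A B C D : BOp H H) (x1 x2 y1 y2 : H) :
  inner (block A B C D ((x1, x2) : dsum H H)) ((y1, y2) : dsum H H)
  = Cplus (Cplus (inner (A x1) y1) (inner (B x2) y1))
          (Cplus (inner (C x1) y2) (inner (D x2) y2)).
Proof. now rewrite -!inner_plus_l. Qed.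

Lemma norm_dsum_swap (H : Hilbert) (x1 x2 : H) :
  norm ((x2, x1) : dsum H H) = norm ((x1, x2) : dsum H H).
Proof. rewrite !norm_dsum; f_equal; ring. Qed.

Lemma tform_diag_le (H : Hilbert) (A B : BOp H H) t (x1 x2 y1 y2 : H) :
  0 <= t <= 1 ->
  tform (dsum H H) t (block A (zero_op H H) (zero_op H H) B) (x1, x2) (y1, y2)
  <= tform H t A x1 y1 + tform H t B x2 y2.
Proof.
  intros Ht; unfold tform; rewrite !inner_block; simpl op.
  rewrite !inner_zero_l !Cplus_0_r !Cplus_0_l.
  generalize (Cmod_triangle (inner (A x1) y1) (inner (B x2) y2))
    (Cmod_triangle (inner (A y1) x1) (inner (B y2) x2)); intros; nra.
Qed.

Lemma tform_offdiag_swap (H : Hilbert) (A B : BOp H H) t (x1 x2 y1 y2 : H) :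
  tform (dsum H H) t (block (zero_op H H) A B (zero_op H H)) (x1, x2) (y1, y2)
  = tform (dsum H H) t (block (zero_op H H) B A (zero_op H H))
      (x2, x1) (y2, y1).
Proof.
  unfold tform; rewrite !inner_block; simpl op.
  rewrite !inner_zero_l !Cplus_0_r !Cplus_0_l.
  now rewrite Cplus_comm (Cplus_comm (inner (A y2) x1)).
Qed.

Lemma tform_corner (H : Hilbert) (A : BOp H H) t (x1 x2 y1 y2 : H) :
  tform (dsum H H) t
    (block (zero_op H H) A (zero_op H H) (zero_op H H)) (x1, x2) (y1, y2)
  = t * Cmod (inner (A x2) y1) + (1 - t) * Cmod (inner (A y2) x1).
Proof.
  unfold tform; rewrite !inner_block; simpl op.
  now rewrite !inner_zero_l !Cplus_0_r !Cplus_0_l.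
Qed.

(** * The Berezin norm inequalities *)

Section BlockBerezin.

Variables (Omega : Type) (H : RKHS Omega) (t : R).
Hypothesis Omega_inh : inhabited Omega.
Hypothesis kernel_neq0 : forall l : Omega, kernel H l <> zero.
Hypothesis t01 : 0 <= t <= 1.

Let k2 (l : Omega * Omega) : dsum H H := (kernel H (fst l), kernel H (snd l)).

Lemma k2_neq0 l : k2 l <> zero.
Proof. intros E; exact (kernel_neq0 (fst l) (f_equal fst E)). Qed.

Lemma inhabited_index2 : inhabited (Omega * Omega).
Proof. destruct Omega_inh as [l]; exact (inhabits (l, l)). Qed.

Lemma tber2_diag_le (A B : BOp H H) :
  tber2 t (block A (zero_op H H) (zero_op H H) B) <= Rmax (tber t A) (tber t B).
Proof.
  apply (tber_of_lub _ _ k2 _ t k2_neq0 _ inhabited_index2).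
  intros [l1 l2] [m1 m2]; unfold k2; simpl fst; simpl snd.
  eapply Rle_trans; [now apply tform_diag_le|].
  assert (UA := tber_of_upper _ _ (kernel H) A t kernel_neq0 t01 l1 m1).
  assert (UB := tber_of_upper _ _ (kernel H) B t kernel_neq0 t01 l2 m2).
  change (tber_of _ t A) with (tber t A) in UA.
  change (tber_of _ t B) with (tber t B) in UB.
  assert (CS := norm_dsum_mult_ge H (kernel H l1) (kernel H l2)
                  (kernel H m1) (kernel H m2)).
  assert (P1 := norm_mult_pos _ _ _ kernel_neq0 l1 m1).
  assert (P2 := norm_mult_pos _ _ _ kernel_neq0 l2 m2).
  (* The bound is nonnegative since [tform] is. *)
  assert (N : 0 <= tber t A).
  { assert (0 <= tform H t A (kernel H l1) (kernel H m1)); [|nra].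
    unfold tform; apply Rplus_le_le_0_compat; apply Rmult_le_pos;
      try apply Cmod_ge_0; lra. }
  generalize (Rmax_l (tber t A) (tber t B)) (Rmax_r (tber t A) (tber t B)).
  set (N' := Rmax _ _); intros LA LB.
  eapply Rle_trans; [apply Rplus_le_compat; [exact UA | exact UB]|].
  apply Rle_trans with (N' * (norm (kernel H l1) * norm (kernel H m1)
                              + norm (kernel H l2) * norm (kernel H m2))).
  - rewrite Rmult_plus_distr_l; apply Rplus_le_compat;
      apply Rmult_le_compat_r; lra.
  - apply Rmult_le_compat_l; [lra | exact CS].
Qed.

Lemma tber2_offdiag_le (A B : BOp H H) :
  tber2 t (block (zero_op H H) A B (zero_op H H))
  <= tber2 t (block (zero_op H H) B A (zero_op H H)).
Proof.
  apply (tber_of_lub _ _ k2 _ t k2_neq0 _ inhabited_index2).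
  intros [l1 l2] [m1 m2]; unfold k2; simpl fst; simpl snd.
  rewrite tform_offdiag_swap.
  rewrite -(norm_dsum_swap H (kernel H l1)) -(norm_dsum_swap H (kernel H m1)).
  exact (tber_of_upper _ _ k2 (block (zero_op H H) B A (zero_op H H)) t
           k2_neq0 t01 (l2, l1) (m2, m1)).
Qed.

Lemma tber2_corner_le (A : BOp H H) :
  tber2 t (block (zero_op H H) A (zero_op H H) (zero_op H H))
  <= Rmax t (1 - t) * ber A.
Proof.
  apply (tber_of_lub _ _ k2 _ t k2_neq0 _ inhabited_index2).
  intros [l1 l2] [m1 m2]; unfold k2; simpl fst; simpl snd.
  rewrite tform_corner.
  assert (U1 := ber_upper Omega H kernel_neq0 A l2 m1).
  assert (U2 := ber_upper Omega H kernel_neq0 A m2 l1).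
  assert (CS := norm_dsum_mult_ge H (kernel H l1) (kernel H l2)
                  (kernel H m2) (kernel H m1)).
  rewrite (norm_dsum_swap H (kernel H m1)) in CS.
  assert (P := norm_mult_pos _ _ _ kernel_neq0 l2 m1).
  assert (C1 := Cmod_ge_0 (inner (A (kernel H l2)) (kernel H m1))).
  assert (C2 := Cmod_ge_0 (inner (A (kernel H m2)) (kernel H l1))).
  assert (N : 0 <= ber A) by nra.
  generalize (Rmax_l t (1 - t)) (Rmax_r t (1 - t)).
  set (s := Rmax _ _); intros L1 L2.
  apply Rle_trans with (s * (ber A * (norm (kernel H l1) * norm (kernel H m2)
                                      + norm (kernel H l2) * norm (kernel H m1)))).
  - apply Rle_trans with (s * Cmod (inner (A (kernel H l2)) (kernel H m1))
                          + s * Cmod (inner (A (kernel H m2)) (kernel H l1))).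
    + apply Rplus_le_compat; now apply Rmult_le_compat_r.
    + rewrite -Rmult_plus_distr_l; apply Rmult_le_compat_l; lra.
  - rewrite Rmult_assoc; apply Rmult_le_compat_l; [lra|].
    now apply Rmult_le_compat_l.
Qed.

End BlockBerezin.

Theorem proposition2p9 (Omega : Type) (HOmega : inhabited Omega)
    (H : RKHS Omega) (Hker : forall l : Omega, kernel H l <> zero)
    (t : R) (Ht : 0 <= t <= 1) (A B : BOp H H) :
  tber2 t (block A (zero_op H H) (zero_op H H) B)
    <= Rmax (tber t A) (tber t B)
  /\ tber2 t (block (zero_op H H) A B (zero_op H H))
     = tber2 t (block (zero_op H H) B A (zero_op H H))
  /\ tber2 t (block (zero_op H H) A (zero_op H H) (zero_op H H))
     <= Rmax t (1 - t) * ber A.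
Proof.
  split; [|split].
  - now apply tber2_diag_le.
  - apply Rle_antisym; now apply tber2_offdiag_le.
  - now apply tber2_corner_le.
Qed.
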